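(* Let $D$ be a free domain and let $\phi$ be a meromorphic function on $D$, with singular set $S$. Then $\phi$ is free holomorphic off its singular set: every point $M\in D\setminus S$ lies in a basic free open set $G_\delta\subseteq D\setminus S$ on which $\phi$ is a bounded nc-function.
   Context: $\mathcal M^d=\bigcup_n\mathcal M_n^d$ ($d$-tuples of $n\times n$ complex matrices). For a matrix $\delta$ of free polynomials, $G_\delta=\{M\in\mathcal M^d:\|\delta(M)\|<1\}$ (basic free open set); the free topology has these as a basis, and a free domain is a free-open set. An nc-function on a set closed under direct sums and unitary conjugation is a graded map $\phi$ ($\phi(x)\in\mathcal M_n$ for $x\in\mathcal M_n^d$) with $\phi(x\oplus y)=\phi(x)\oplus\phi(y)$ and $\phi(s^{-1}xs)=s^{-1}\phi(x)s$ whenever defined. A free holomorphic function on a free domain $D$ is a function such that every $M\in D$ lies in some $G_\delta\subseteq D$ on which it is a bounded nc-function. A meromorphic function on $D$ is any function built from free holomorphic functions on $D$ by finitely many arithmetic operations (addition, multiplication, scalar multiplication, and inversion $x\mapsto \psi(x)^{-1}$), taken with a fixed such presentation; its singular set is the set of $x\in D$ at which, at some stage of evaluating $\phi(x)$ via this presentation, one must invert a matrix that is not invertible. *)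

(* Defs.v *)
(* Scalars: complex R = R[i] for an arbitrary R : realType
   (every realType is a model of the real numbers, so complex R is C). *)
From HB Require Import structures.
From mathcomp Require Import all_boot all_order all_algebra.
From mathcomp Require Import complex.
From mathcomp Require Import reals.
Set Implicit Arguments. Unset Strict Implicit. Unset Printing Implicit Defensive.
Import Order.TTheory GRing.Theory Num.Theory.
Local Open Scope ring_scope.

Section FreeDefs.
Variable R : realType.
Local Notation C := (complex R).
Variable d : nat.

Definition tup (n : nat) := 'I_d -> 'M[C]_n.
Definition point := {n : nat & tup n}.
Definition pset := point -> Prop.

Inductive ncpoly :=
| NVar of 'I_d
| NConst of C
| NAdd of ncpoly & ncpoly
| NMul of ncpoly & ncpoly.

Fixpoint ncpeval (p : ncpoly) (n : nat) (x : tup n) : 'M[C]_n :=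
  match p with
  | NVar i => x i
  | NConst c => c%:M
  | NAdd p1 p2 => ncpeval p1 x + ncpeval p2 x
  | NMul p1 p2 => ncpeval p1 x *m ncpeval p2 x
  end.

Definition sqnorm (n : nat) (v : 'cV[C]_n) : C := \sum_(a < n) `|v a 0| ^+ 2.

Record ncmat := NCMat { nc_rows : nat; nc_cols : nat;
                        nc_ent : 'I_nc_rows -> 'I_nc_cols -> ncpoly }.

(* || delta(M) || < 1 : the block operator (C^n)^q -> (C^n)^p has operator norm
   < 1, i.e. there is c < 1 with ||delta(M) v|| <= c ||v|| for all v. *)
Definition in_G (delta : ncmat) (M : point) : Prop :=
  let: existT n x := M in
  exists c : C, 0 <= c /\ c < 1 /\
    forall v : 'I_(nc_cols delta) -> 'cV[C]_n,
      \sum_(i < nc_rows delta)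
         sqnorm (\sum_(j < nc_cols delta) ncpeval (@nc_ent delta i j) x *m v j)
      <= c ^+ 2 * \sum_(j < nc_cols delta) sqnorm (v j).

Definition psubset (A B : pset) := forall M, A M -> B M.

Definition free_open (D : pset) : Prop :=
  forall M, D M -> exists delta, in_G delta M /\ psubset (in_G delta) D.

Definition ncfun := forall n : nat, tup n -> 'M[C]_n.
Definition app (phi : ncfun) (M : point) : 'M[C]_(projT1 M) := phi _ (projT2 M).

Definition dsum n m (x : tup n) (y : tup m) : tup (n + m) :=
  fun i => block_mx (x i) 0 0 (y i).
Definition conj n (s : 'M[C]_n) (x : tup n) : tup n :=
  fun i => invmx s *m x i *m s.

Definition nc_on (E : pset) (phi : ncfun) : Prop :=
  (forall n m (x : tup n) (y : tup m),
      E (existT _ n x) -> E (existT _ m y) ->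
      phi _ (dsum x y) = block_mx (phi n x) 0 0 (phi m y)) /\
  (forall n (x : tup n) (s : 'M[C]_n), s \in unitmx ->
      E (existT _ n x) -> E (existT _ n (conj s x)) ->
      phi n (conj s x) = invmx s *m phi n x *m s).

Definition opnorm_le n (A : 'M[C]_n) (K : C) : Prop :=
  forall v : 'cV[C]_n, sqnorm (A *m v) <= K ^+ 2 * sqnorm v.

Definition bounded_on (E : pset) (phi : ncfun) : Prop :=
  exists K : C, 0 <= K /\ forall M, E M -> opnorm_le (app phi M) K.

Definition free_holo (D : pset) (phi : ncfun) : Prop :=
  forall M, D M -> exists delta, in_G delta M /\ psubset (in_G delta) D /\
     nc_on (in_G delta) phi /\ bounded_on (in_G delta) phi.

(* presentations of meromorphic functions *)
Inductive mexpr :=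
| MHol of ncfun
| MAdd of mexpr & mexpr
| MMul of mexpr & mexpr
| MScal of C & mexpr
| MInv of mexpr.

Fixpoint holo_leaves (D : pset) (e : mexpr) : Prop :=
  match e with
  | MHol f => free_holo D f
  | MAdd e1 e2 | MMul e1 e2 => holo_leaves D e1 /\ holo_leaves D e2
  | MScal _ e1 | MInv e1 => holo_leaves D e1
  end.

(* evaluation; None = a non-invertible matrix had to be inverted *)
Fixpoint meval (e : mexpr) (n : nat) (x : tup n) : option 'M[C]_n :=
  match e with
  | MHol f => Some (f n x)
  | MAdd e1 e2 => match meval e1 x, meval e2 x with
                  | Some a, Some b => Some (a + b) | _, _ => None end
  | MMul e1 e2 => match meval e1 x, meval e2 x with
                  | Some a, Some b => Some (a *m b) | _, _ => None end
  | MScal c e1 => match meval e1 x with Some a => Some (c *: a) | None => None end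
  | MInv e1 => match meval e1 x with
               | Some a => if a \in unitmx then Some (invmx a) else None
               | None => None end
  end.

Definition singular_set (D : pset) (e : mexpr) : pset :=
  fun M => D M /\ meval e (projT2 M) = None.

(* the meromorphic function (its value off the singular set) *)
Definition mfun (e : mexpr) : ncfun :=
  fun n x => match meval e x with Some a => a | None => 0 end.

End FreeDefs.

(* Main.v *)
Require Import Defs.
From mathcomp Require Import all_boot all_order all_algebra complex reals.
From mathcomp Require Import boolp ring lra zify.
Set Implicit Arguments. Unset Strict Implicit. Unset Printing Implicit Defensive.
Import Order.TTheory GRing.Theory Num.Theory.
Local Open Scope ring_scope.

(* Only inversion needs an argument.  Let psi be a bounded nc-function on G_delta
   with psi(M) invertible.  Let m_1, ..., m_k be free polynomials whose values at
   M form an orthonormal basis of the algebra generated by M, and let T be the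
   tuple of left multiplications by M in that basis; T lies in G_delta, and psi(T)
   is invertible since T is contained in a direct sum of copies of M.  For x near
   M and a vector v, the matrix S with columns m_j(x) v almost intertwines
   delta(T) and delta(x), because the columns of delta(x) S - S delta(T) are values
   at x of polynomials vanishing at M.  Hence the conjugate of T (+) x by
   [1 0; S/eps 1] stays in G_delta, and boundedness of psi there gives
   |psi(x) S - S psi(T)| <= eps |psi|.  Applied to the psi(T)^-1-image of the
   coordinates of 1, this yields a polynomial q with psi(x) q(x) v close to v,
   uniformly in v, on a basic free neighbourhood of M. *)

(** * Squared norms with real values *)

Section RealNorm.
Variable R : realType.
Local Notation C := (complex R).

(** The squared modulus is taken in [R] rather than in [C], so that estimates are inequalities in a
    real field, within reach of [lra]. *)
Definition nsq (z : C) : R := complex.Re z ^+ 2 + complex.Im z ^+ 2.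
Definition sqn n (v : 'cV[C]_n) : R := \sum_(a < n) nsq (v a 0).

Lemma nsq_ge0 z : 0 <= nsq z.
Proof. by rewrite addr_ge0 ?sqr_ge0. Qed.

Lemma nsqM z w : nsq (z * w) = nsq z * nsq w.
Proof. by case: z w => [a b] [a' b']; rewrite /nsq /=; ring. Qed.

(** Weighted Young inequality: in each real coordinate the gap is [t^-1 * (t * a - b) ^+ 2]. A small
    weight [t] keeps the first coefficient close to 1. *)
Lemma nsqD_le t z w : 0 < t -> nsq (z + w) <= (1 + t) * nsq z + (1 + t^-1) * nsq w.
Proof.
move=> t0.
have le (a b : R) : (a + b) ^+ 2 <= (1 + t) * a ^+ 2 + (1 + t^-1) * b ^+ 2.
  rewrite -subr_ge0.
  have -> : (1 + t) * a ^+ 2 + (1 + t^-1) * b ^+ 2 - (a + b) ^+ 2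
            = t^-1 * (t * a - b) ^+ 2 by field; rewrite gt_eqF.
  by rewrite mulr_ge0 ?sqr_ge0 ?invr_ge0 ?ltW.
case: z w => [a b] [a' b']; rewrite /nsq /=.
have := lerD (le a a') (le b b'); lra.
Qed.

Lemma nsqr (r : R) : nsq r%:C%C = r ^+ 2.
Proof. by rewrite /nsq /= expr0n addr0. Qed.

Lemma sqnormE n (v : 'cV[C]_n) : sqnorm v = (sqn v)%:C%C.
Proof. by rewrite /sqnorm /sqn rmorph_sum; apply: eq_bigr => a _; rewrite -add_Re2_Im2. Qed.

Lemma sqn_ge0 n (v : 'cV[C]_n) : 0 <= sqn v.
Proof. by apply: sumr_ge0 => a _; exact: nsq_ge0. Qed.

Lemma sqn0 n : sqn (0 : 'cV[C]_n) = 0.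
Proof. by apply: big1 => a _; rewrite mxE /nsq /= expr0n addr0. Qed.

Lemma sqn_eq0 n (v : 'cV[C]_n) : sqn v = 0 -> v = 0.
Proof.
move=> /eqP; rewrite psumr_eq0 => [/allP v0|a _]; last exact: nsq_ge0.
apply/colP => a; have := v0 a (mem_index_enum _).
rewrite mxE /nsq /= paddr_eq0 ?sqr_ge0 // !sqrf_eq0 => /andP[/eqP re /eqP im].
by rewrite [LHS]complexE re im mulr0 addr0.
Qed.

Lemma sqn_gt0 n (v : 'cV[C]_n) : v != 0 -> 0 < sqn v.
Proof.
move=> v0; rewrite lt_neqAle sqn_ge0 eq_sym andbT.
by apply: contra v0 => /eqP /sqn_eq0 ->.
Qed.

Lemma sqnZ n z (v : 'cV[C]_n) : sqn (z *: v) = nsq z * sqn v.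
Proof. by rewrite /sqn mulr_sumr; apply: eq_bigr => a _; rewrite mxE nsqM. Qed.

Lemma sqnZr n (r : R) (v : 'cV[C]_n) : sqn (r%:C%C *: v) = r ^+ 2 * sqn v.
Proof. by rewrite sqnZ nsqr. Qed.

Lemma sqnN n (v : 'cV[C]_n) : sqn (- v) = sqn v.
Proof. by rewrite -scaleN1r sqnZ /nsq /= oppr0 expr0n addr0 sqrrN expr1n mul1r. Qed.

Lemma sqnD_le t n (v w : 'cV[C]_n) : 0 < t ->
  sqn (v + w) <= (1 + t) * sqn v + (1 + t^-1) * sqn w.
Proof.
move=> t0; rewrite /sqn !mulr_sumr -big_split /=.
by apply: ler_sum => a _; rewrite mxE nsqD_le.
Qed.

(** Cauchy-Schwarz by induction: splitting one term off a sum of [q.+2] with weight [t = q.+1] gives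
    both parts the factor [q.+2]. *)
Lemma sqn_sum_le q n (w : 'I_q -> 'cV[C]_n) :
  sqn (\sum_j w j) <= q%:R * \sum_j sqn (w j).
Proof.
elim: q w => [|[|q] IH] w; first by rewrite !big_ord0 sqn0 mulr0.
  by rewrite !big_ord1 mul1r.
rewrite big_ord_recl [in leRHS]big_ord_recl.
have := IH (fun j => w (lift ord0 j)).
set s := \sum_(i < q.+1) sqn _ => le1.
have s0 : 0 <= s by apply: sumr_ge0 => j _; exact: sqn_ge0.
have q0 : 0 < q.+1%:R :> R by rewrite ltr0n.
apply: le_trans (sqnD_le _ _ q0) _.
rewrite -[q.+2%:R]natr1 [_ + 1]addrC mulrDr lerD2l.
apply: le_trans (_ : (1 + q.+1%:R^-1) * (q.+1%:R * s) <= _).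
  by rewrite ler_wpM2l // addr_ge0 ?invr_ge0 ?ltW.
by rewrite le_eqVlt; apply/orP; left; apply/eqP; rewrite mulrA mulrDl mulVf ?gt_eqF ?mul1r 1?addrC.
Qed.

Lemma sqn_col_mx n m (v : 'cV[C]_n) (w : 'cV[C]_m) :
  sqn (col_mx v w) = sqn v + sqn w.
Proof.
rewrite /sqn big_split_ord /=; congr (_ + _); apply: eq_bigr => a _.
  by rewrite col_mxEu.
by rewrite col_mxEd.
Qed.

Lemma mulmx_col_sum k n (A : 'M[C]_(n, k)) (g : 'cV[C]_k) :
  A *m g = \sum_l g l 0 *: col l A.
Proof.
apply/colP => a; rewrite mxE summxE; apply: eq_bigr => l _.
by rewrite !mxE mulrC.
Qed.

Lemma sqn_mulmx_le k n (A : 'M[C]_(n, k)) (K : R) (g : 'cV[C]_k) :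
  (forall l, sqn (col l A) <= K) -> sqn (A *m g) <= k%:R * K * sqn g.
Proof.
move=> AK; rewrite mulmx_col_sum; apply: le_trans (sqn_sum_le _) _.
rewrite -mulrA ler_wpM2l // mulr_sumr; apply: ler_sum => l _.
by rewrite sqnZ mulrC ler_wpM2r ?nsq_ge0.
Qed.

Lemma mulmx_bounded k n (A : 'M[C]_(n, k)) :
  exists2 K : R, 0 <= K & forall g, sqn (A *m g) <= K * sqn g.
Proof.
exists (k%:R * \sum_l sqn (col l A)).
  by rewrite mulr_ge0 // sumr_ge0 // => l _; exact: sqn_ge0.
move=> g; apply: sqn_mulmx_le => l; rewrite (bigD1 l) //= lerDl sumr_ge0 // => *.
exact: sqn_ge0.
Qed.

Lemma ler_sqnD2 n (v w : 'cV[C]_n) : sqn (v + w) <= 2 * sqn v + 2 * sqn w.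
Proof. by have := sqnD_le v w (@ltr01 R); rewrite invr1. Qed.

End RealNorm.

Lemma split_lshift m n (j : 'I_m) : split (lshift n j) = inl j.
Proof. exact: (unsplitK (inl j)). Qed.

Lemma split_rshift m n (j : 'I_n) : split (rshift m j) = inr j.
Proof. exact: (unsplitK (inr j)). Qed.

(** * Neighbourhoods in the free topology *)

Section Neighbourhoods.
Variables (R : realType) (d : nat).
Local Notation C := (complex R).

(** [K] bounds the square of the operator norm, which avoids most square roots. *)
Definition contr (delta : ncmat R d) (K : R) n (x : tup R d n) : Prop :=
  forall v : 'I_(nc_cols delta) -> 'cV[C]_n,
    \sum_i sqn (\sum_j ncpeval (nc_ent i j) x *m v j) <= K * \sum_j sqn (v j).

Lemma in_GP delta n (x : tup R d n) :
  in_G delta (existT _ n x) <-> exists K, [/\ 0 <= K, K < 1 & contr delta K x].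
Proof.
have E (c : R) v : (\sum_(i < nc_rows delta)
         sqnorm (\sum_(j < nc_cols delta) ncpeval (@nc_ent _ _ delta i j) x *m v j)
      <= c%:C%C ^+ 2 * \sum_(j < nc_cols delta) sqnorm (v j)) =
    (\sum_i sqn (\sum_j ncpeval (@nc_ent _ _ delta i j) x *m v j)
      <= c ^+ 2 * \sum_j sqn (v j)).
  under eq_bigr do rewrite sqnormE.
  under [\sum_j sqnorm _]eq_bigr do rewrite sqnormE.
  by rewrite -!rmorph_sum -rmorphXn -rmorphM lecR.
split=> [[c [c0 [c1 cP]]]|[K [K0 K1 KP]]].
  have := RRe_real (ger0_real c0); set r := complex.Re c => cE.
  move: c0 c1 cP; rewrite -cE ler0c -(rmorph1 (real_complex R)) ltcR => c0 c1 cP.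
  exists (r ^+ 2); split; [exact: sqr_ge0|by rewrite expr_lt1|].
  by move=> v; rewrite -E.
(* The mean of 1 and [K] is below 1 and at least the square root of [K]. *)
exists ((1 + K) / 2)%:C%C; rewrite ler0c -(rmorph1 (real_complex R)) ltcR.
split; first lra.
split; first lra.
move=> v; rewrite E; apply: le_trans (KP v) _; apply: ler_wpM2r.
  by apply: sumr_ge0 => j _; exact: sqn_ge0.
by rewrite -subr_ge0 (_ : _ - K = ((1 - K) / 2) ^+ 2) ?sqr_ge0 //; field.
Qed.

Lemma bounded_onP (E : pset R d) (phi : ncfun R d) :
  bounded_on E phi <-> exists2 K : R, 0 <= K &
    forall n (x : tup R d n), E (existT _ n x) ->
    forall v, sqn (phi n x *m v) <= K * sqn v.
Proof.
split=> [[c [c0 cP]]|[K K0 KP]].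
  have cE := RRe_real (ger0_real c0).
  exists (complex.Re c ^+ 2) => [|n x Ex v]; first exact: sqr_ge0.
  by have := cP _ Ex v; rewrite !sqnormE -cE -rmorphXn -rmorphM lecR.
exists (Num.sqrt K)%:C%C; split=> [|[n x] Ex v]; first by rewrite ler0c sqrtr_ge0.
by rewrite !sqnormE -rmorphXn -rmorphM lecR sqr_sqrtr //; exact: KP.
Qed.

Definition nbhd (M : point R d) (U : pset R d) :=
  exists2 delta, in_G delta M & psubset (in_G delta) U.

Lemma nbhdS M (U V : pset R d) : psubset U V -> nbhd M U -> nbhd M V.
Proof. by move=> UV [delta GM GU]; exists delta => // N /GU /UV. Qed.

Lemma nbhdT M : nbhd M (fun=> True).
Proof.
exists (NCMat (fun (_ _ : 'I_0) => NConst d 0)) => //; case: M => n x.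
by apply/in_GP; exists 0; split=> // v; rewrite big_ord0 mul0r.
Qed.

(** Its basic free open set is the intersection of the two given ones. *)
Definition diag_ncmat (de1 de2 : ncmat R d) : ncmat R d :=
  @NCMat R d (nc_rows de1 + nc_rows de2) (nc_cols de1 + nc_cols de2)
   (fun i j => match split i, split j with
    | inl i, inl j => nc_ent i j
    | inr i, inr j => nc_ent i j
    | _, _ => NConst d 0 end).

Lemma contr_diagP de1 de2 K n (x : tup R d n) :
  contr (diag_ncmat de1 de2) K x <-> contr de1 K x /\ contr de2 K x.
Proof.
have E v :
  \sum_(i < nc_rows (diag_ncmat de1 de2)) sqn (\sum_(j < nc_cols (diag_ncmat de1 de2))
     ncpeval (@nc_ent _ _ (diag_ncmat de1 de2) i j) x *m v j)
  = \sum_i sqn (\sum_j ncpeval (@nc_ent _ _ de1 i j) x *m v (lshift _ j))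
  + \sum_i sqn (\sum_j ncpeval (@nc_ent _ _ de2 i j) x *m v (rshift _ j)).
  rewrite /= big_split_ord /=; congr (_ + _); apply: eq_bigr => i _; congr sqn.
    rewrite big_split_ord /= [X in _ + X]big1 ?addr0 => [|j _].
      by apply: eq_bigr => j _; rewrite !split_lshift.
    by rewrite split_lshift split_rshift /= raddf0 mul0mx.
  rewrite big_split_ord /= [X in X + _]big1 ?add0r => [|j _].
    by apply: eq_bigr => j _; rewrite !split_rshift.
  by rewrite split_lshift split_rshift /= raddf0 mul0mx.
split=> [c12|[c1 c2] v].
  split=> v.
    pose w (j : 'I_(nc_cols de1 + nc_cols de2)) :=
      match split j with inl j => v j | inr _ => 0 end.
    have wl j : w (lshift _ j) = v j by rewrite /w split_lshift.
    have wr j : w (rshift _ j) = 0 by rewrite /w split_rshift.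
    have := c12 w; rewrite E /= [X in K * X]big_split_ord /=.
    rewrite [X in _ + X <= _]big1 => [|i _]; last first.
      by rewrite big1 ?sqn0 // => j _; rewrite wr mulmx0.
    rewrite [X in K * (_ + X)]big1 => [|i _]; last by rewrite wr sqn0.
    rewrite !addr0; under [X in K * X]eq_bigr do rewrite wl.
    by under eq_bigr do under eq_bigr do rewrite wl.
  pose w (j : 'I_(nc_cols de1 + nc_cols de2)) :=
    match split j with inl _ => 0 | inr j => v j end.
  have wl j : w (lshift _ j) = 0 by rewrite /w split_lshift.
  have wr j : w (rshift _ j) = v j by rewrite /w split_rshift.
  have := c12 w; rewrite E /= [X in K * X]big_split_ord /=.
  rewrite [X in X + _ <= _]big1 => [|i _]; last first.
    by rewrite big1 ?sqn0 // => j _; rewrite wl mulmx0.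
  rewrite [X in K * (X + _)]big1 => [|i _]; last by rewrite wl sqn0.
  rewrite !add0r; under [X in K * X]eq_bigr do rewrite wr.
  by under eq_bigr do under eq_bigr do rewrite wr.
rewrite E /= [X in K * X]big_split_ord /= mulrDr.
exact: lerD (c1 _) (c2 _).
Qed.

Lemma contr_le de K1 K2 n (x : tup R d n) : K1 <= K2 -> contr de K1 x -> contr de K2 x.
Proof.
move=> K12 c1 v; apply: le_trans (c1 v) _; apply: ler_wpM2r => //.
by apply: sumr_ge0 => j _; exact: sqn_ge0.
Qed.

Lemma nbhdI M (U V : pset R d) : nbhd M U -> nbhd M V -> nbhd M (fun N => U N /\ V N).
Proof.
move=> [de1 G1 U1] [de2 G2 V2]; exists (diag_ncmat de1 de2) => [|[n x] /in_GP].
  case: M G1 G2 => n x /in_GP[K1 [K10 K11 c1]] /in_GP[K2 [K20 K21 c2]].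
  apply/in_GP; exists (Num.max K1 K2); rewrite le_max K10 gt_max K11 K21; split=> //.
  apply/contr_diagP; split; [apply: contr_le c1|apply: contr_le c2];
  by rewrite le_max lexx ?orbT.
move=> [K [K0 K1 /contr_diagP[c1 c2]]].
by split; [apply: U1|apply: V2]; apply/in_GP; exists K.
Qed.

Lemma nbhd_forall (I : finType) M (U : I -> pset R d) :
  (forall i, nbhd M (U i)) -> nbhd M (fun N => forall i, U i N).
Proof.
move=> MU; suff: nbhd M (fun N => forall i, i \in enum I -> U i N).
  by apply: nbhdS => N UN i; apply: UN; rewrite mem_enum.
elim: (enum I) => [|i s IH]; first exact: nbhdS (nbhdT M).
apply: nbhdS (nbhdI (MU i) IH) => N [Ui Us] j; rewrite inE => /predU1P[->//|].
exact: Us.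
Qed.

Definition nscale (r : R) (p : ncpoly R d) := NMul (NConst d r%:C%C) p.

Lemma ncpeval_nscale r p n (x : tup R d n) :
  ncpeval (nscale r p) x = r%:C%C *: ncpeval p x.
Proof. by rewrite /= mul_scalar_mx. Qed.

(** Membership in [in_G delta] gives each point its own constant below 1. Dividing [delta] by [r]
    with [K0 < r ^+ 2 < 1] yields one constant for a whole neighbourhood, so that later tolerances
    do not depend on the point. *)
Lemma nbhd_contr delta M : in_G delta M ->
  exists K, [/\ 0 <= K, K < 1, contr delta K (projT2 M) &
    nbhd M (fun N => contr delta K (projT2 N))].
Proof.
case: M => n x /in_GP[K0 [K00 K01 c0]] /=.
pose r := (1 + K0) / 2.
have r0 : 0 < r by rewrite /r; lra.
have [K0r r1] : K0 < r ^+ 2 /\ r < 1.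
  split; last by rewrite /r; lra.
  rewrite -subr_gt0 (_ : _ - K0 = ((1 - K0) / 2) ^+ 2); last by rewrite /r; field.
  by rewrite exprn_gt0 //; lra.
exists (r ^+ 2); split; [exact: sqr_ge0|by rewrite expr_lt1 ?ltW|exact: contr_le (ltW K0r) c0|].
pose de := NCMat (fun i j => nscale r^-1 (@nc_ent _ _ delta i j)).
have E m (y : tup R d m) v : \sum_(i < nc_rows de)
    sqn (\sum_(j < nc_cols de) ncpeval (@nc_ent _ _ de i j) y *m v j)
    = (r ^+ 2)^-1 * \sum_i sqn (\sum_j ncpeval (@nc_ent _ _ delta i j) y *m v j).
  rewrite mulr_sumr; apply: eq_bigr => i _.
  rewrite -exprVn -sqnZr scaler_sumr; congr sqn; apply: eq_bigr => j _.
  by rewrite ncpeval_nscale scalemxAl.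
have r2 : 0 < r ^+ 2 by rewrite exprn_gt0.
exists de.
  apply/in_GP; exists (K0 / r ^+ 2); split.
  - by rewrite divr_ge0 // ltW.
  - by rewrite ltr_pdivrMr // mul1r.
  move=> v; rewrite E mulrC [K0 / _ * _]mulrAC ler_wpM2r ?invr_ge0 ?(ltW r2) //; exact: c0.
move=> [m y] /in_GP[K [_ K1 cK]] v /=.
have := cK v; rewrite E mulrC ler_pdivrMr // => /le_trans; apply.
rewrite mulrC ler_wpM2l ?(ltW r2) // ler_piMl ?(ltW K1) // sumr_ge0 // => j _.
exact: sqn_ge0.
Qed.

(** The 1-by-1 matrix with entry [p] divided by the square root of [K'] cuts out the neighbourhood;
    [K < K'] puts [M] inside it. *)
Lemma nbhd_le p M (K K' : R) : 0 <= K -> K < K' ->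
  (forall v, sqn (ncpeval p (projT2 M) *m v) <= K * sqn v) ->
  nbhd M (fun N => forall v, sqn (ncpeval p (projT2 N) *m v) <= K' * sqn v).
Proof.
move=> K0 KK' pM; have K'0 := le_lt_trans K0 KK'.
pose r := Num.sqrt K'^-1.
have r2 : r ^+ 2 = K'^-1 by rewrite sqr_sqrtr // invr_ge0 ltW.
pose de := NCMat (fun (_ _ : 'I_1) => nscale r p).
have E m (y : tup R d m) v : \sum_(i < nc_rows de)
    sqn (\sum_(j < nc_cols de) ncpeval (@nc_ent _ _ de i j) y *m v j)
    = K'^-1 * sqn (ncpeval p y *m v ord0).
  by rewrite /= !big_ord1 mul_scalar_mx -scalemxAl sqnZr r2.
exists de.
  case: M pM => n x pM; apply/in_GP; exists (K / K'); split.
  - by rewrite divr_ge0 // ltW.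
  - by rewrite ltr_pdivrMr // mul1r.
  move=> v; rewrite E big_ord1 mulrC [K / _ * _]mulrAC ler_wpM2r ?invr_ge0 ?(ltW K'0) //.
move=> [m y] /in_GP[L [_ L1 cL]] v /=.
have := cL (fun=> v); rewrite E big_ord1 mulrC ler_pdivrMr // => /le_trans; apply.
by rewrite mulrC ler_wpM2l ?(ltW K'0) // ler_piMl ?sqn_ge0 // ltW.
Qed.

Lemma nbhd_small p M (K : R) : 0 < K -> ncpeval p (projT2 M) = 0 ->
  nbhd M (fun N => forall v, sqn (ncpeval p (projT2 N) *m v) <= K * sqn v).
Proof.
by move=> K0 p0; apply: (nbhd_le (lexx 0)) => // v; rewrite p0 mul0mx sqn0 mul0r.
Qed.

Lemma nbhd_bounded p M : exists2 K : R, 0 <= K &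
  nbhd M (fun N => forall v, sqn (ncpeval p (projT2 N) *m v) <= K * sqn v).
Proof.
have [K K0 pK] := mulmx_bounded (ncpeval p (projT2 M)).
exists (K + 1); [by rewrite addr_ge0|apply: nbhd_le pK => //].
by rewrite ltrDl.
Qed.

End Neighbourhoods.

(** * An orthonormal basis of the algebra generated by a point *)

Section Algebra.
Variables (R : realType) (d : nat).
Local Notation C := (complex R).

Definition lincomb k (m : 'I_k -> ncpoly R d) (g : 'cV[C]_k) : ncpoly R d :=
  foldr (fun j p => NAdd (NMul (NConst d (g j 0)) (m j)) p) (NConst d 0) (enum 'I_k).

Lemma ncpeval_lincomb k (m : 'I_k -> ncpoly R d) g n (x : tup R d n) :
  ncpeval (lincomb m g) x = \sum_j g j 0 *: ncpeval (m j) x.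
Proof.
rewrite -big_enum /lincomb /=; elim: (enum _) => [|j s IH] /=.
  by rewrite big_nil raddf0.
by rewrite big_cons IH mul_scalar_mx.
Qed.

(* The linear map C^k -> C^n, g |-> (sum_j g_j m_j)(x) v. *)
Definition orbit_mx k (m : 'I_k -> ncpoly R d) n (x : tup R d n) (v : 'cV[C]_n) :
  'M[C]_(n, k) := \matrix_(b, j) (ncpeval (m j) x *m v) b 0.

Lemma col_orbit_mx k (m : 'I_k -> ncpoly R d) n (x : tup R d n) v j :
  col j (orbit_mx m x v) = ncpeval (m j) x *m v.
Proof. by apply/colP => b; rewrite !mxE. Qed.

Lemma orbit_mx_mul k (m : 'I_k -> ncpoly R d) n (x : tup R d n) v g :
  orbit_mx m x v *m g = ncpeval (lincomb m g) x *m v.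
Proof.
rewrite mulmx_col_sum ncpeval_lincomb mulmx_suml; apply: eq_bigr => j _.
by rewrite col_orbit_mx scalemxAl.
Qed.

Definition evec n (a : 'I_n) : 'cV[C]_n := delta_mx a 0.

Lemma eq_mulmx_evec n p (A B : 'M[C]_(p, n)) :
  (forall a, A *m evec a = B *m evec a) -> A = B.
Proof.
by move=> AB; apply/matrixP => i a; have /colP/(_ i) := AB a; rewrite -!colE !mxE.
Qed.

Lemma mulmx1C_eq k n (A : 'M[C]_(k, n)) (B : 'M[C]_(n, k)) :
  k = n -> A *m B = 1%:M -> B *m A = 1%:M.
Proof. by move=> kn; move: A B; rewrite kn => A B /mulmx1C. Qed.

Lemma conj_sqnorm n (v : 'cV[C]_n) : (map_mx Num.conj v)^T *m v = (sqnorm v)%:M.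
Proof.
apply/matrixP => i j; rewrite !ord1 !mxE /sqnorm mulr1n; apply: eq_bigr => a _.
by rewrite !mxE normCK mulrC.
Qed.

Lemma sqn_isometry n k (W : 'M[C]_(n, k)) h :
  (map_mx Num.conj W)^T *m W = 1%:M -> sqn (W *m h) = sqn h.
Proof.
move=> W1; apply: (@complexI R); rewrite -!sqnormE.
have : (sqnorm (W *m h))%:M = (sqnorm h)%:M :> 'M_1.
  by rewrite -!conj_sqnorm map_mxM trmx_mul mulmxA -(mulmxA _ _ W) W1 mulmx1.
by move/matrixP/(_ 0 0); rewrite !mxE !mulr1n.
Qed.

(** Both sides are the squared Frobenius norm, summed by columns and by entries. *)
Lemma sum_sqn_col n (A : 'M[C]_n) : \sum_a sqn (A *m evec a) = sqn (mxvec A)^T.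
Proof.
rewrite /sqn exchange_big /= pair_bigA /=.
rewrite [RHS](reindex _ (curry_mxvec_bij _ _)) /=; apply: eq_bigr => -[b a] _ /=.
by rewrite -colE !mxE mxvecE.
Qed.

(** Each value becomes a vector of length [n * n], so orthonormal columns mean orthonormality for
    the Frobenius inner product. *)
Definition family_mx k (m : 'I_k -> ncpoly R d) n (x : tup R d n) : 'M[C]_(n * n, k) :=
  \matrix_(i, j) mxvec (ncpeval (m j) x) 0 i.

Lemma family_mx_mul k (m : 'I_k -> ncpoly R d) n (x : tup R d n) g :
  family_mx m x *m g = (mxvec (ncpeval (lincomb m g) x))^T.
Proof.
rewrite ncpeval_lincomb linear_sum /= linear_sum /= mulmx_col_sum.
by apply: eq_bigr => j _; apply/colP => i; rewrite !linearZ !mxE.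
Qed.

(** Gram-Schmidt on values of free polynomials at [x]; it stops because an orthonormal family has at
    most [n * n] members. The isometry clause is orthonormality, read off the columns of the value
    of [lincomb m h]. *)
Lemma alg_basis n (x : tup R d n) : exists k (m : 'I_k -> ncpoly R d),
  (forall h, \sum_a sqn (orbit_mx m x (evec a) *m h) = sqn h) /\
  (forall p, exists g : 'cV[C]_k, ncpeval p x = ncpeval (lincomb m g) x).
Proof.
suff [k [m [m1 mP]]] : exists k (m : 'I_k -> ncpoly R d),
  (map_mx Num.conj (family_mx m x))^T *m family_mx m x = 1%:M /\
  (forall p, exists g : 'cV[C]_k, ncpeval p x = ncpeval (lincomb m g) x).
  exists k, m; split=> // h; rewrite -(sqn_isometry _ m1) family_mx_mul.
  by rewrite -sum_sqn_col; apply: eq_bigr => a _; rewrite orbit_mx_mul.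
(* Induction on the number of dimensions not yet filled, starting from the empty family. *)
suff IH N k (m : 'I_k -> ncpoly R d) : (n * n - k < N)%N ->
    (map_mx Num.conj (family_mx m x))^T *m family_mx m x = 1%:M ->
    exists k (m : 'I_k -> ncpoly R d),
    (map_mx Num.conj (family_mx m x))^T *m family_mx m x = 1%:M /\
    (forall p, exists g : 'cV[C]_k, ncpeval p x = ncpeval (lincomb m g) x).
  apply: (IH (n * n).+1 0%N (fun=> NConst d 0)); first by rewrite subn0.
  by apply/matrixP => -[].
elim: N k m => // N IH k m kN m1.
have kn := mulmx1_min m1.
have [mP|/existsNP[p /forallNP pP]] := pselect
    (forall p, exists g : 'cV[C]_k, ncpeval p x = ncpeval (lincomb m g) x).
  by exists k, m.
set W := family_mx m x in m1; set Ws := (map_mx _ W)^T in m1.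
pose w := (mxvec (ncpeval p x))^T.
(* [p'] is [p] minus its orthogonal projection to the span of the family, hence nonzero at [x] by
   the choice of [p]. *)
pose p' := NAdd p (NMul (NConst d (-1)) (lincomb m (Ws *m w))).
have p'E : ncpeval p' x = ncpeval p x - ncpeval (lincomb m (Ws *m w)) x.
  by rewrite /= mul_scalar_mx scaleN1r.
pose r := (mxvec (ncpeval p' x))^T.
have rE : r = w - W *m (Ws *m w).
  by rewrite /r p'E !linearB /= family_mx_mul.
have Wr : Ws *m r = 0 by rewrite rE mulmxBr !mulmxA m1 mul1mx subrr.
have r0 : r != 0.
  apply/negP => /eqP /(congr1 trmx); rewrite trmxK trmx0 => /(canRL mxvecK).
  by rewrite linear0 p'E => /eqP; rewrite subr_eq0 => /eqP /pP.
have sr : 0 < sqn r by exact: sqn_gt0.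
pose c := Num.sqrt (sqn r)^-1.
pose u := c%:C%C *: r.
have su : sqnorm u = 1.
  by rewrite sqnormE sqnZr sqr_sqrtr ?invr_ge0 ?sqn_ge0 // mulVf ?gt_eqF.
pose m' (j : 'I_(k + 1)) := match split j with inl j => m j | inr _ => nscale c p' end.
have m'E : family_mx m' x = row_mx W u.
  apply/matrixP => i j; rewrite [LHS]mxE [RHS]mxE /m'.
  case: (split j) => j'; first by rewrite !mxE.
  by rewrite ncpeval_nscale linearZ /u /r ord1 [RHS]mxE [in RHS]mxE [LHS]mxE.
apply: (IH (k + 1)%N m').
  (* With [k = n * n] the matrix [W] would be square, hence unitary, and the residual [r] would
     vanish. *)
  have km : (k + 1 <= n * n)%N.
    rewrite addn1 ltn_neqAle kn andbT; apply: contra r0 => /eqP kE.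
    by rewrite rE mulmxA (mulmx1C_eq kE m1) mul1mx subrr.
  lia.
rewrite m'E map_row_mx tr_row_mx mul_col_row m1 -/Ws.
have -> : Ws *m u = 0 by rewrite -scalemxAr Wr scaler0.
have -> : (map_mx Num.conj u)^T *m W = 0.
  have /(congr1 (fun A => (map_mx Num.conj A)^T)) : Ws *m u = 0.
    by rewrite -scalemxAr Wr scaler0.
  rewrite map_mxM trmx_mul map_mx0 trmx0 /Ws -map_trmx trmxK.
  by rewrite -map_mx_comp (map_mx_id (@conjCK _)).
by rewrite conj_sqnorm su -scalar_mx_block.
Qed.

(* T is left multiplication by x on the algebra generated by x, in an orthonormal basis. *)
Lemma alg_action n (x : tup R d n) : exists k (m : 'I_k -> ncpoly R d) (T : tup R d k),
  [/\ forall h, \sum_a sqn (orbit_mx m x (evec a) *m h) = sqn h,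
   forall p, exists g : 'cV[C]_k, ncpeval p x = ncpeval (lincomb m g) x &
   forall i a, x i *m orbit_mx m x (evec a) = orbit_mx m x (evec a) *m T i].
Proof.
have [k [m [m1 mP]]] := alg_basis x; exists k, m.
(* Structure constants: the coordinates of [x i] times the [j]-th basis element. *)
pose t i j := sval (cid (mP (NMul (NVar R i) (m j)))).
have tP i j : x i *m ncpeval (m j) x = ncpeval (lincomb m (t i j)) x.
  by rewrite /t; case: cid.
exists (fun i => \matrix_(h, j) t i j h 0); split=> // i a.
apply: eq_mulmx_evec => j; rewrite -!mulmxA -!colE col_orbit_mx mulmxA tP.
by rewrite -orbit_mx_mul; congr (_ *m _); apply/colP => h; rewrite !mxE.
Qed.

Lemma ncpeval_intertwine n k (x : tup R d n) (T : tup R d k) (L : 'M[C]_(n, k)) p :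
  (forall i, x i *m L = L *m T i) -> ncpeval p x *m L = L *m ncpeval p T.
Proof.
move=> xL; elim: p => [i|c|p IHp q IHq|p IHp q IHq] //=.
- by rewrite mul_scalar_mx mul_mx_scalar.
- by rewrite mulmxDl mulmxDr IHp IHq.
- by rewrite -mulmxA IHq mulmxA IHp mulmxA.
Qed.

(** Stacked, the [W a] form an isometry into [n] copies of the space of [x] that intertwines [T]
    with the [n]-fold direct sum of [x]. So [delta] at [T] is a restriction of copies of [delta] at
    [x]. *)
Lemma contr_isometry n k (x : tup R d n) (T : tup R d k)
    (W : 'I_n -> 'M[C]_(n, k)) delta K :
  (forall h, \sum_a sqn (W a *m h) = sqn h) ->
  (forall i a, x i *m W a = W a *m T i) ->
  contr delta K x -> contr delta K T.
Proof.
move=> W1 xW cx v.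
under eq_bigr do rewrite -W1; under [X in K * X]eq_bigr do rewrite -W1.
rewrite exchange_big [X in K * X]exchange_big mulr_sumr /=; apply: ler_sum => a _.
apply: le_trans (cx (fun j => W a *m v j)).
rewrite le_eqVlt; apply/orP; left; apply/eqP; apply: eq_bigr => i _.
rewrite mulmx_sumr; congr sqn; apply: eq_bigr => j _; rewrite !mulmxA.
by rewrite (ncpeval_intertwine _ (xW ^~ a)).
Qed.

End Algebra.

(** * Conjugating direct sums by shears *)

Section Triangular.
Variables (R : realType) (d : nat).
Local Notation C := (complex R).

Definition shear n m (L : 'M[C]_(m, n)) : 'M[C]_(n + m) := block_mx 1%:M 0 L 1%:M.

Lemma shear_unit n m (L : 'M[C]_(m, n)) : shear L \in unitmx.
Proof. by rewrite unitmxE det_lblock !det1 mulr1 unitr1. Qed.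

Lemma invmx_shear n m (L : 'M[C]_(m, n)) : invmx (shear L) = shear (- L).
Proof.
have sK : shear L *m shear (- L) = 1%:M.
  rewrite mulmx_block !(mulmx1, mul1mx, mulmx0, mul0mx, addr0, add0r) subrr.
  by rewrite -scalar_mx_block.
by rewrite -[LHS]mulmx1 -sK mulmxA mulVmx ?shear_unit // mul1mx.
Qed.

(** The corner measures how far [L] is from intertwining [A] and [B]; through it, similarity
    invariance yields information on intertwiners, exact or approximate. *)
Lemma shear_conj n m (L : 'M[C]_(m, n)) A B :
  invmx (shear L) *m block_mx A 0 0 B *m shear L
  = block_mx A 0 (B *m L - L *m A) B.
Proof.
rewrite invmx_shear !mulmx_block.
by rewrite !(mulmx1, mul1mx, mulmx0, mul0mx, addr0, add0r) mulNmx addrC.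
Qed.

Lemma ncpeval_dsum n m (x : tup R d n) (y : tup R d m) p :
  ncpeval p (dsum x y) = block_mx (ncpeval p x) 0 0 (ncpeval p y).
Proof.
elim: p => [i|c|p IHp q IHq|p IHp q IHq] //=.
- by rewrite scalar_mx_block.
- by rewrite IHp IHq add_block_mx !addr0.
- by rewrite IHp IHq mulmx_block !(mulmx0, mul0mx, addr0, add0r).
Qed.

Lemma ncpeval_conj n (s : 'M[C]_n) (x : tup R d n) p : s \in unitmx ->
  ncpeval p (Defs.conj s x) = invmx s *m ncpeval p x *m s.
Proof.
move=> us; elim: p => [i|c|p IHp q IHq|p IHp q IHq] //=.
- by rewrite mul_mx_scalar -scalemxAl mulVmx // scalemx1.
- by rewrite IHp IHq mulmxDr mulmxDl.
- by rewrite IHp IHq !mulmxA mulmxK.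
Qed.

Lemma ncpeval_shear n m (L : 'M[C]_(m, n)) (x : tup R d n) (y : tup R d m) p :
  ncpeval p (Defs.conj (shear L) (dsum x y)) =
  block_mx (ncpeval p x) 0 (ncpeval p y *m L - L *m ncpeval p x) (ncpeval p y).
Proof. by rewrite ncpeval_conj ?shear_unit // ncpeval_dsum shear_conj. Qed.

Lemma nc_on_shear (E : pset R d) phi n m (L : 'M[C]_(m, n)) (x : tup R d n)
    (y : tup R d m) : nc_on E phi ->
  E (existT _ n x) -> E (existT _ m y) -> E (existT _ _ (dsum x y)) ->
  E (existT _ _ (Defs.conj (shear L) (dsum x y))) ->
  phi _ (Defs.conj (shear L) (dsum x y)) =
  block_mx (phi _ x) 0 (phi _ y *m L - L *m phi _ x) (phi _ y).
Proof.
move=> [phiD phiJ] Ex Ey Exy Es.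
by rewrite phiJ ?shear_unit // phiD // shear_conj.
Qed.

(** For an exact intertwiner the shear fixes [dsum x y], so the two formulas for [phi] there agree
    and the corner is zero. *)
Lemma nc_on_intertwine (E : pset R d) phi n m (L : 'M[C]_(m, n)) (x : tup R d n)
    (y : tup R d m) : nc_on E phi ->
  E (existT _ n x) -> E (existT _ m y) -> E (existT _ _ (dsum x y)) ->
  (forall i, y i *m L = L *m x i) -> phi _ y *m L = L *m phi _ x.
Proof.
move=> ncphi Ex Ey Exy yL.
have sE : Defs.conj (shear L) (dsum x y) = dsum x y.
  by apply/funext => i; rewrite /Defs.conj shear_conj yL subrr.
have := nc_on_shear (L := L) ncphi Ex Ey Exy; rewrite sE => /(_ Exy).
rewrite (proj1 ncphi) // => /eq_block_mx[_ _ /esym/eqP]; rewrite subr_eq0.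
by move/eqP.
Qed.

Lemma sum_col_mx (I : finType) n m (a : I -> 'cV[C]_n) (b : I -> 'cV[C]_m) :
  \sum_j col_mx (a j) (b j) = col_mx (\sum_j a j) (\sum_j b j).
Proof.
by elim/big_rec3: _ => [|j u v w _ ->]; rewrite ?col_mx0 ?add_col_mx.
Qed.

(** The weighted inequality with [t = (1 - K) / 2] absorbs the corner: [(1 + t) * K] stays below
    [(1 + K) / 2] on the [y] side, and the corner costs at most [(1 - K) / 2] on the [x] side. *)
Lemma in_G_lower (delta : ncmat R d) K L n m (x : tup R d n) (y : tup R d m)
    (z : tup R d (n + m)) F :
  0 <= K -> K < 1 -> 0 <= L -> L * (1 + 2 / (1 - K)) <= (1 - K) / 2 ->
  contr delta K x -> contr delta K y ->
  (forall i j, ncpeval (@nc_ent _ _ delta i j) z =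
     block_mx (ncpeval (nc_ent i j) x) 0 (F i j) (ncpeval (nc_ent i j) y)) ->
  (forall g, \sum_i sqn (\sum_j F i j *m g j) <= L * \sum_j sqn (g j)) ->
  in_G delta (existT _ _ z).
Proof.
move=> K0 K1 L0 LK cx cy zE FL; apply/in_GP; exists ((1 + K) / 2); split; [lra|lra|].
move=> v.
pose g j := usubmx (v j); pose w j := dsubmx (v j).
have vE j : v j = col_mx (g j) (w j) by rewrite vsubmxK.
have E i : sqn (\sum_j ncpeval (@nc_ent _ _ delta i j) z *m v j) =
    sqn (\sum_j ncpeval (@nc_ent _ _ delta i j) x *m g j) +
    sqn (\sum_j ncpeval (@nc_ent _ _ delta i j) y *m w j + \sum_j F i j *m g j).
  rewrite -sqn_col_mx; congr sqn.
  transitivity (\sum_j col_mx (ncpeval (nc_ent i j) x *m g j)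
     (ncpeval (nc_ent i j) y *m w j + F i j *m g j)).
    by apply: eq_bigr => j _; rewrite zE vE mul_block_col mul0mx addr0 addrC.
  by rewrite sum_col_mx big_split.
under eq_bigr do rewrite E; rewrite big_split /=.
have -> : \sum_j sqn (v j) = \sum_j sqn (g j) + \sum_j sqn (w j).
  by rewrite -big_split; apply: eq_bigr => j _; rewrite vE sqn_col_mx.
have := cx g; have := cy w; have := FL g.
have : 0 <= \sum_j sqn (w j) by apply: sumr_ge0 => j _; exact: sqn_ge0.
have : 0 <= \sum_j sqn (g j) by apply: sumr_ge0 => j _; exact: sqn_ge0.
pose t := (1 - K) / 2; have t0 : 0 < t by rewrite /t; lra.
have : \sum_i sqn (\sum_j ncpeval (@nc_ent _ _ delta i j) y *m w j + \sum_j F i j *m g j)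
  <= (1 + t) * \sum_i sqn (\sum_j ncpeval (@nc_ent _ _ delta i j) y *m w j)
   + (1 + t^-1) * \sum_i sqn (\sum_j F i j *m g j).
  by rewrite !mulr_sumr -big_split; apply: ler_sum => i _; exact: sqnD_le.
rewrite (_ : t^-1 = 2 / (1 - K)) ?invf_div //; set u := 1 + 2 / (1 - K) in LK *.
have u0 : 0 < u by rewrite addr_gt0 ?divr_gt0 ?subr_gt0.
set G := \sum_j sqn (g j); set W := \sum_j sqn (w j).
set B := \sum_i sqn (\sum_j F i j *m g j).
set A := \sum_i sqn (\sum_j ncpeval (nc_ent i j) y *m w j).
move=> le1 G0 W0 leB leA leX.
have h1 : (1 + t) * A <= (1 + t) * (K * W) by rewrite ler_wpM2l //; lra.
have h2 : u * B <= (1 - K) / 2 * G.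
  apply: le_trans (_ : u * (L * G) <= _); first by rewrite ler_wpM2l // ltW.
  by rewrite mulrA [u * L]mulrC ler_wpM2r.
have h3 : (1 + t) * (K * W) <= (1 + K) / 2 * W.
  rewrite mulrA ler_wpM2r // -subr_ge0.
  rewrite (_ : _ - _ = 2 * t ^+ 2); last by rewrite /t; field.
  by rewrite mulr_ge0 ?sqr_ge0.
lra.
Qed.

Lemma in_G_dsum (delta : ncmat R d) n m (x : tup R d n) (y : tup R d m) :
  in_G delta (existT _ n x) -> in_G delta (existT _ m y) ->
  in_G delta (existT _ _ (dsum x y)).
Proof.
move=> /in_GP[K1 [K10 K11 c1]] /in_GP[K2 [K20 K21 c2]].
have c1' : contr delta (Num.max K1 K2) x by apply: contr_le c1; rewrite le_max lexx.
have c2' : contr delta (Num.max K1 K2) y by apply: contr_le c2; rewrite le_max lexx orbT.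
apply: (@in_G_lower _ _ 0 _ _ _ _ _ (fun _ _ => 0) _ _ _ _ c1' c2').
- by rewrite le_max K10.
- by rewrite gt_max K11.
- exact: lexx.
- by rewrite mul0r divr_ge0 // subr_ge0 ge_max !ltW.
- by move=> i j; rewrite ncpeval_dsum.
move=> g; rewrite mul0r big1 // => i _.
by rewrite big1 ?sqn0 // => j _; rewrite mul0mx.
Qed.

End Triangular.

(** * Polynomial approximate inverses near a point *)

Section NearInverse.
Variables (R : realType) (d : nat).
Local Notation C := (complex R).

Lemma inj_unitmx n (A : 'M[C]_n) : (forall v : 'cV_n, A *m v = 0 -> v = 0) -> A \in unitmx.
Proof.
move=> Ainj; rewrite -unitmx_tr -row_free_unit -kermx_eq0.
apply/rowV0P => h /sub_kermxP /(congr1 trmx); rewrite trmx_mul trmxK trmx0 => /Ainj h0.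
by apply: trmx_inj; rewrite h0 trmx0.
Qed.

(** A single free polynomial [q] serves all sizes at once, so bounds on [q] near [M] will become
    bounds on the inverse. The factor [4^-1] is a relative error of one half in norm. *)
Lemma near_right_inverse (delta : ncmat R d) (M : point R d) (psi : ncfun R d) :
  in_G delta M -> nc_on (in_G delta) psi -> bounded_on (in_G delta) psi ->
  app psi M \in unitmx ->
  exists q, nbhd M (fun N => in_G delta N /\ forall v,
    sqn (app psi N *m (ncpeval q (projT2 N) *m v) - v) <= 4^-1 * sqn v).
Proof.
move=> GM ncpsi /bounded_onP[B B0 psiB] uM.
have [K [K0 K1 cM nbK]] := nbhd_contr GM.
case: M GM uM cM nbK => n x /= GM uM cM nbK.
have [k [m [T [m1 mP xT]]]] := alg_action x.
have cT : contr delta K T := contr_isometry m1 xT cM.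
have GT : in_G delta (existT _ k T) by apply/in_GP; exists K.
have psiT a : psi n x *m orbit_mx m x (evec _ a) = orbit_mx m x (evec _ a) *m psi k T.
  exact: (nc_on_intertwine ncpsi GT GM (in_G_dsum GT GM) (xT ^~ a)).
(* A kernel vector [h] of [psi k T] is sent to 0 by every [orbit_mx m x (evec a)], since [psi n x]
   is invertible; jointly these are isometric, so [h = 0]. *)
have uT : psi k T \in unitmx.
  apply: inj_unitmx => h Th; apply: sqn_eq0.
  rewrite -m1 big1 // => a _.
  by rewrite -[orbit_mx _ _ _](mulKmx uM) psiT -!mulmxA Th !mulmx0 sqn0.
(* [al] holds the coordinates of the identity, and [be] is its preimage under [psi k T]. *)
have [al alE] := mP (NConst d 1).
pose be := invmx (psi k T) *m al.
exists (lincomb m be).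
(* [rho] is the squared scale of the intertwiner, large enough to bring the bound [B * sqn be / rho]
   below [16^-1]; the added 1 keeps it positive. *)
pose rho := 16 * B * sqn be + 1.
have rho0 : 0 < rho by rewrite ltr_wpDl // !mulr_ge0 // sqn_ge0.
(* If every column of every corner block has squared norm at most [rho * eta], the whole corner has
   squared norm at most [A * eta]. *)
pose A : R := (nc_rows delta)%:R * ((nc_cols delta)%:R * (k%:R * rho)).
have A0 : 0 <= A by rewrite !mulr_ge0 // ltW.
pose Z : R := 1 + 2 / (1 - K).
have Z0 : 0 < Z by rewrite addr_gt0 ?divr_gt0 ?subr_gt0.
(* [eta] is fitted to the corner condition of [in_G_lower]. *)
have [eta eta0 etaZ] : exists2 eta, 0 < eta & A * eta * Z <= (1 - K) / 2.
  have A1 : 0 < A + 1 by rewrite ltr_wpDl.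
  exists ((1 - K) / 2 / ((A + 1) * Z)).
    by rewrite !divr_gt0 ?subr_gt0 // mulr_gt0.
  have -> : A * ((1 - K) / 2 / ((A + 1) * Z)) * Z = (1 - K) / 2 * (A / (A + 1)).
    by field; rewrite (gt_eqF Z0) (gt_eqF A1).
  rewrite ler_piMr // ?divr_ge0 ?subr_ge0 ?(ltW K1) //.
  by rewrite ler_pdivrMr // mul1r lerDl.
(* Applied to [v], the value of [ga i j l] is column [l] of the intertwining defect of
   [orbit_mx m y v]; [ka] measures how far [lincomb m al] is from 1. Both vanish at [x]. *)
pose ga i j l := NAdd (NMul (@nc_ent _ _ delta i j) (m l))
  (NMul (NConst d (-1)) (lincomb m (col l (ncpeval (@nc_ent _ _ delta i j) T)))).
pose ka := NAdd (lincomb m al) (NConst d (-1)).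
have gaE i j l N (y : tup R d N) v : ncpeval (ga i j l) y *m v =
    col l (ncpeval (nc_ent i j) y *m orbit_mx m y v
           - orbit_mx m y v *m ncpeval (nc_ent i j) T).
  rewrite /= mul_scalar_mx scaleN1r mulmxBl -orbit_mx_mul.
  rewrite linearB /= [in RHS]colE -mulmxA -colE col_orbit_mx mulmxA; congr (_ - _).
  by rewrite [in RHS]colE -mulmxA -colE.
have ga0 i j l : ncpeval (ga i j l) x = 0.
  apply: eq_mulmx_evec => a; rewrite gaE mul0mx.
  by rewrite (ncpeval_intertwine _ (xT ^~ a)) subrr linear0.
have kaE N (y : tup R d N) v : ncpeval ka y *m v = orbit_mx m y v *m al - v.
  by rewrite /= mulmxDl orbit_mx_mul mul_scalar_mx scaleN1r.
have ka0 : ncpeval ka x = 0.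
  apply: eq_mulmx_evec => a; rewrite kaE mul0mx orbit_mx_mul -alE /=.
  by rewrite mul1mx subrr.
have nbga : nbhd (existT _ n x) (fun N => forall t :
    'I_(nc_rows delta) * 'I_(nc_cols delta) * 'I_k, forall v,
    sqn (ncpeval (ga t.1.1 t.1.2 t.2) (projT2 N) *m v) <= eta * sqn v).
  by apply: nbhd_forall => t; apply: nbhd_small.
have nbka := @nbhd_small R d ka (existT _ n x) 16^-1 _ ka0.
apply: nbhdS (nbhdI nbK (nbhdI nbga (nbka _))) => [[N y] /= [cy [gay kay]]|]; last first.
  by rewrite invr_gt0.
have Gy : in_G delta (existT _ N y) by apply/in_GP; exists K.
split=> // v; rewrite /app /=.
have [v0|vn0] := eqVneq v 0.
  by rewrite v0 !mulmx0 subr0 sqn0 mulr0.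
have sv : 0 < sqn v by exact: sqn_gt0.
(* Normalising by [sqn v] makes the corner bound independent of [v]; hence the separate case
   [v = 0]. *)
pose r := Num.sqrt (rho / sqn v).
have r2 : r ^+ 2 = rho / sqn v by rewrite sqr_sqrtr // divr_ge0 // ltW.
pose S := orbit_mx m y v; pose L := r%:C%C *: S.
pose F i j := ncpeval (@nc_ent _ _ delta i j) y *m L - L *m ncpeval (nc_ent i j) T.
have Fl i j l : sqn (col l (F i j)) <= rho * eta.
  have -> : col l (F i j) = r%:C%C *: (ncpeval (ga i j l) y *m v).
    by rewrite gaE /F /L -scalemxAl -scalemxAr -scalerBr linearZ.
  rewrite sqnZr r2 -mulrA ler_wpM2l ?(ltW rho0) // mulrC ler_pdivrMr //.
  exact: (gay (i, j, l)).
have GY : in_G delta (existT _ _ (Defs.conj (shear L) (dsum T y))).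
  apply: (@in_G_lower R d delta K (A * eta) _ _ T y _ F) => //.
  - by rewrite mulr_ge0 // ltW.
  - by move=> i j; rewrite ncpeval_shear.
  move=> g; rewrite /A -!mulrA.
  apply: le_trans (_ : \sum_(i < nc_rows delta) (nc_cols delta)%:R *
      (k%:R * (rho * (eta * \sum_j sqn (g j)))) <= _); last first.
    by rewrite sumr_const card_ord -[leLHS]mulr_natl.
  apply: ler_sum => i _; apply: le_trans (sqn_sum_le _) _.
  rewrite ler_wpM2l // !mulr_sumr; apply: ler_sum => j _.
  by apply: le_trans (sqn_mulmx_le _ (Fl i j)) _; rewrite !mulrA.
(* On [col_mx be 0] the lower component is the corner of [psi] applied to [be], where
   [psi k T *m be] is [al]. *)
have := psiB _ _ GY (col_mx be 0).
rewrite (nc_on_shear ncpsi GT Gy (in_G_dsum GT Gy) GY).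
rewrite mul_block_col !mulmx0 !addr0 !sqn_col_mx sqn0 addr0.
have -> : (psi N y *m L - L *m psi k T) *m be = r%:C%C *: (psi N y *m (S *m be) - S *m al).
  rewrite /L -scalemxAr -!scalemxAl -scalerBr -scalemxAl mulmxBl -!mulmxA.
  by rewrite /be mulKVmx.
rewrite sqnZr r2 => le1.
have le2 : rho * sqn (psi N y *m (S *m be) - S *m al) <= B * sqn be * sqn v.
  rewrite -ler_pdivrMr // mulrAC; apply: le_trans le1.
  by rewrite lerDr sqn_ge0.
have le3 := kay v; rewrite kaE -/S in le3.
rewrite -orbit_mx_mul -/S.
have -> : psi N y *m (S *m be) - v = (psi N y *m (S *m be) - S *m al) + (S *m al - v).
  by rewrite addrA subrK.
(* Two errors of [16^-1], each doubled, add up to [4^-1]. *)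
apply: le_trans (ler_sqnD2 _ _) _.
have le4 : sqn (psi N y *m (S *m be) - S *m al) <= 16^-1 * sqn v.
  rewrite -(ler_pM2l rho0); apply: le_trans le2 _.
  rewrite mulrA ler_wpM2r ?(ltW sv) // /rho; lra.
lra.
Qed.

(** A vector killed by [A *m Q] would have squared norm at most a quarter of itself. *)
Lemma right_inverse_unitmx n (A Q : 'M[C]_n) :
  (forall v, sqn (A *m (Q *m v) - v) <= 4^-1 * sqn v) -> A \in unitmx.
Proof.
move=> AQ; suff: A *m Q \in unitmx by rewrite unitmx_mul => /andP[].
apply: inj_unitmx => v; rewrite -mulmxA => AQv; apply: sqn_eq0.
have := AQ v; rewrite AQv sub0r sqnN; have := sqn_ge0 v; lra.
Qed.

(** With [w = A *m (Q *m v)], closeness of [w] to [v] gives [sqn v <= 4 * sqn w], while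
    [invmx A *m w] is [Q *m v]. *)
Lemma right_inverse_bound n (A Q : 'M[C]_n) (K : R) : 0 <= K ->
  (forall v, sqn (A *m (Q *m v) - v) <= 4^-1 * sqn v) ->
  (forall v, sqn (Q *m v) <= K * sqn v) ->
  forall v, sqn (invmx A *m v) <= K * 4 * sqn v.
Proof.
move=> K0 AQ QK w; have uA := right_inverse_unitmx AQ.
have uQ : Q \in unitmx.
  apply: inj_unitmx => v Qv; apply: sqn_eq0.
  have := AQ v; rewrite Qv mulmx0 sub0r sqnN; have := sqn_ge0 v; lra.
pose v := invmx Q *m (invmx A *m w).
have Qv : Q *m v = invmx A *m w by rewrite /v mulKVmx.
have AQv : A *m (Q *m v) = w by rewrite Qv mulKVmx.
rewrite -Qv; apply: le_trans (QK v) _; rewrite -mulrA ler_wpM2l //.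
have := AQ v; rewrite AQv => le1.
have := ler_sqnD2 w (v - w); rewrite addrC subrK -[v - w]opprB sqnN; lra.
Qed.

End NearInverse.

(** * Arithmetic operations and induction on presentations *)

Section Meromorphic.
Variables (R : realType) (d : nat).
Local Notation C := (complex R).

Lemma nc_onS (E F : pset R d) phi : psubset E F -> nc_on F phi -> nc_on E phi.
Proof.
move=> EF [phiD phiJ]; split=> [n m x y /EF Fx /EF Fy|n x s us /EF Fx /EF Fs].
  exact: phiD.
exact: phiJ.
Qed.

Lemma bounded_onS (E F : pset R d) phi :
  psubset E F -> bounded_on F phi -> bounded_on E phi.
Proof. by move=> EF [K [K0 KP]]; exists K; split=> // N /EF; exact: KP. Qed.

(** The domain is a basic free open set because [dsum x y] must lie in it as well. *)
Lemma nc_on_eq delta (phi psi : ncfun R d) :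
  (forall n x, in_G delta (existT _ n x) -> phi n x = psi n x) ->
  nc_on (in_G delta) psi -> nc_on (in_G delta) phi.
Proof.
move=> eqf [psiD psiJ]; split=> [n m x y Gx Gy|n x s us Gx Gs].
  by rewrite !eqf ?psiD //; exact: in_G_dsum.
by rewrite !eqf ?psiJ.
Qed.

Lemma bounded_on_eq (E : pset R d) (phi psi : ncfun R d) :
  (forall n x, E (existT _ n x) -> phi n x = psi n x) ->
  bounded_on E psi -> bounded_on E phi.
Proof.
move=> eqf [K [K0 KP]]; exists K; split=> // -[n x] Ex.
by rewrite /app /= eqf //; exact: (KP _ Ex).
Qed.

Lemma nc_onD (E : pset R d) (phi psi : ncfun R d) : nc_on E phi -> nc_on E psi ->
  nc_on E (fun n x => phi n x + psi n x).
Proof.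
move=> [phiD phiJ] [psiD psiJ]; split=> [n m x y Ex Ey|n x s us Ex Es].
  by rewrite phiD // psiD // add_block_mx !addr0.
by rewrite phiJ // psiJ // mulmxDr mulmxDl.
Qed.

Lemma nc_onM (E : pset R d) (phi psi : ncfun R d) : nc_on E phi -> nc_on E psi ->
  nc_on E (fun n x => phi n x *m psi n x).
Proof.
move=> [phiD phiJ] [psiD psiJ]; split=> [n m x y Ex Ey|n x s us Ex Es].
  by rewrite phiD // psiD // mulmx_block !(mulmx0, mul0mx, addr0, add0r).
by rewrite phiJ // psiJ // !mulmxA mulmxK.
Qed.

Lemma nc_onZ (E : pset R d) c (phi : ncfun R d) : nc_on E phi ->
  nc_on E (fun n x => c *: phi n x).
Proof.
move=> [phiD phiJ]; split=> [n m x y Ex Ey|n x s us Ex Es].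
  by rewrite phiD // scale_block_mx !scaler0.
by rewrite phiJ // -scalemxAr -scalemxAl.
Qed.

Lemma mulmx1_invmx n (A B : 'M[C]_n) : A *m B = 1%:M -> invmx A = B.
Proof.
by move=> AB; have [uA _] := mulmx1_unit AB; rewrite -[RHS](mulKmx uA) AB mulmx1.
Qed.

Lemma nc_onV (E : pset R d) (phi : ncfun R d) : nc_on E phi ->
  (forall n x, E (existT _ n x) -> phi n x \in unitmx) ->
  nc_on E (fun n x => invmx (phi n x)).
Proof.
move=> [phiD phiJ] uphi; split=> [n m x y Ex Ey|n x s us Ex Es].
  rewrite phiD // invmx_block_diag // unitmxE det_lblock.
  by rewrite unitrM -!unitmxE !uphi.
rewrite phiJ //; apply: mulmx1_invmx; have ux := uphi _ _ Ex.
by rewrite !mulmxA mulmxK // mulmxK // mulVmx.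
Qed.

Lemma bounded_onD (E : pset R d) (phi psi : ncfun R d) :
  bounded_on E phi -> bounded_on E psi -> bounded_on E (fun n x => phi n x + psi n x).
Proof.
move=> /bounded_onP[K K0 KP] /bounded_onP[L L0 LP]; apply/bounded_onP.
exists (2 * K + 2 * L) => [|n x Ex v]; first by rewrite addr_ge0 // mulr_ge0.
rewrite mulmxDl; apply: le_trans (ler_sqnD2 _ _) _.
have := KP _ _ Ex v; have := LP _ _ Ex v; lra.
Qed.

Lemma bounded_onM (E : pset R d) (phi psi : ncfun R d) :
  bounded_on E phi -> bounded_on E psi -> bounded_on E (fun n x => phi n x *m psi n x).
Proof.
move=> /bounded_onP[K K0 KP] /bounded_onP[L L0 LP]; apply/bounded_onP.
exists (K * L) => [|n x Ex v]; first exact: mulr_ge0.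
rewrite -mulmxA -mulrA; apply: le_trans (KP _ _ Ex _) _.
by rewrite ler_wpM2l // LP.
Qed.

Lemma bounded_onZ (E : pset R d) c (phi : ncfun R d) :
  bounded_on E phi -> bounded_on E (fun n x => c *: phi n x).
Proof.
move=> /bounded_onP[K K0 KP]; apply/bounded_onP.
exists (nsq c * K) => [|n x Ex v]; first by rewrite mulr_ge0 ?nsq_ge0.
by rewrite -scalemxAl sqnZ -mulrA ler_wpM2l ?nsq_ge0 // KP.
Qed.

(** Definedness of the evaluation is part of the local property, so that it is carried along the
    induction on [e]. *)
Definition holo_at (D : pset R d) (e : mexpr R d) (M : point R d) : Prop :=
  exists delta, [/\ in_G delta M,
    psubset (in_G delta) (fun N => D N /\ meval e (projT2 N) <> None),
    nc_on (in_G delta) (mfun e) & bounded_on (in_G delta) (mfun e)].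

Lemma meval_mfun (e : mexpr R d) n (x : tup R d n) :
  meval e x <> None -> meval e x = Some (mfun e x).
Proof. by rewrite /mfun; case: meval. Qed.

Lemma holo_at2 (D : pset R d) (e1 e2 : mexpr R d) M :
  holo_at D e1 M -> holo_at D e2 M ->
  exists delta, [/\ in_G delta M,
    forall n x, in_G delta (existT _ n x) ->
      [/\ D (existT _ n x), meval e1 x = Some (mfun e1 x) & meval e2 x = Some (mfun e2 x)],
    nc_on (in_G delta) (mfun e1), nc_on (in_G delta) (mfun e2) &
    bounded_on (in_G delta) (mfun e1) /\ bounded_on (in_G delta) (mfun e2)].
Proof.
move=> [de1 [G1 D1 nc1 b1]] [de2 [G2 D2 nc2 b2]].
have [delta GM GG] : nbhd M (fun N => in_G de1 N /\ in_G de2 N).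
  by apply: nbhdI; [exists de1|exists de2].
have S1 : psubset (in_G delta) (in_G de1) by move=> N /GG[].
have S2 : psubset (in_G delta) (in_G de2) by move=> N /GG[].
exists delta; split=> //; [|exact: nc_onS nc1|exact: nc_onS nc2|].
  move=> n x Gx; have [Dx e1x] := D1 _ (S1 _ Gx); have [_ e2x] := D2 _ (S2 _ Gx).
  by split=> //; exact: meval_mfun.
by split; [exact: bounded_onS b1|exact: bounded_onS b2].
Qed.

Lemma holo_atD (D : pset R d) (e1 e2 : mexpr R d) M :
  holo_at D e1 M -> holo_at D e2 M -> holo_at D (MAdd e1 e2) M.
Proof.
move=> h1 h2; have [delta [GM eP nc1 nc2 [b1 b2]]] := holo_at2 h1 h2.
have eqf n x : in_G delta (existT _ n x) ->
    mfun (MAdd e1 e2) x = mfun e1 x + mfun e2 x.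
  by move=> /eP[_ e1x e2x]; rewrite {1}/mfun /= e1x e2x.
exists delta; split=> //.
- by move=> [n x] /eP[Dx e1x e2x]; rewrite /= e1x e2x.
- exact: nc_on_eq eqf (nc_onD nc1 nc2).
- exact: bounded_on_eq eqf (bounded_onD b1 b2).
Qed.

Lemma holo_atM (D : pset R d) (e1 e2 : mexpr R d) M :
  holo_at D e1 M -> holo_at D e2 M -> holo_at D (MMul e1 e2) M.
Proof.
move=> h1 h2; have [delta [GM eP nc1 nc2 [b1 b2]]] := holo_at2 h1 h2.
have eqf n x : in_G delta (existT _ n x) ->
    mfun (MMul e1 e2) x = mfun e1 x *m mfun e2 x.
  by move=> /eP[_ e1x e2x]; rewrite {1}/mfun /= e1x e2x.
exists delta; split=> //.
- by move=> [n x] /eP[Dx e1x e2x]; rewrite /= e1x e2x.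
- exact: nc_on_eq eqf (nc_onM nc1 nc2).
- exact: bounded_on_eq eqf (bounded_onM b1 b2).
Qed.

Lemma holo_atZ (D : pset R d) c (e : mexpr R d) M :
  holo_at D e M -> holo_at D (MScal c e) M.
Proof.
move=> [delta [GM eP nce be]].
have eqf n x : in_G delta (existT _ n x) -> mfun (MScal c e) x = c *: mfun e x.
  by move=> /eP[_ /meval_mfun ex]; rewrite {1}/mfun /= ex.
exists delta; split=> //.
- by move=> [n x] /eP[Dx /meval_mfun ex]; rewrite /= ex.
- exact: nc_on_eq eqf (nc_onZ c nce).
- exact: bounded_on_eq eqf (bounded_onZ c be).
Qed.

(** On a smaller basic set the polynomial [q] is bounded and nearly inverts [mfun e] from the right:
    this gives invertibility at every point and a uniform bound on the inverse. *)
Lemma holo_atV (D : pset R d) (e : mexpr R d) M :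
  app (mfun e) M \in unitmx -> holo_at D e M -> holo_at D (MInv e) M.
Proof.
move=> uM [delta [GM eP nce be]].
have [q nbq] := near_right_inverse GM nce be uM.
have [K K0 nbK] := nbhd_bounded q M.
have [de dM deP] := nbhdI nbq nbK.
have sub : psubset (in_G de) (in_G delta) by move=> N /deP[[]].
have ux n x : in_G de (existT _ n x) -> mfun e x \in unitmx.
  by move=> /deP[[_ /right_inverse_unitmx]].
have eqf n x : in_G de (existT _ n x) -> mfun (MInv e) x = invmx (mfun e x).
  move=> Gx; have [_ /meval_mfun ex] := eP _ (sub _ Gx).
  by rewrite {1}/mfun /= ex ux.
exists de; split=> //.
- move=> [n x] Gx; have [Dx /meval_mfun ex] := eP _ (sub _ Gx).
  by split=> //=; rewrite ex ux.
- exact: nc_on_eq eqf (nc_onV (nc_onS sub nce) ux).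
- apply: bounded_on_eq eqf _; apply/bounded_onP; exists (K * 4).
    by rewrite mulr_ge0.
  move=> n x /deP[[_ AQ] QK] v; exact: right_inverse_bound AQ QK v.
Qed.

(** Induction on the presentation: [None] propagates upwards, so a defined value at [M] makes all
    subexpressions defined there, and invertible under [MInv]. *)
Lemma holo_atP (D : pset R d) (e : mexpr R d) M : holo_leaves D e ->
  D M -> meval e (projT2 M) <> None -> holo_at D e M.
Proof.
move=> + DM; elim: e => [f|e1 IH1 e2 IH2|e1 IH1 e2 IH2|c e IH|e IH] /=.
- move=> /(_ _ DM)[delta [GM [sD [ncf bf]]]] _; exists delta; split=> //.
  by move=> N /sD.
- move=> [h1 h2]; case E1: (meval e1 _) => [a1|//]; case E2: (meval e2 _) => [a2|//] _.
  by apply: holo_atD; [apply: IH1|apply: IH2]; rewrite ?E1 ?E2.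
- move=> [h1 h2]; case E1: (meval e1 _) => [a1|//]; case E2: (meval e2 _) => [a2|//] _.
  by apply: holo_atM; [apply: IH1|apply: IH2]; rewrite ?E1 ?E2.
- move=> h; case E: (meval e _) => [a|//] _.
  by apply: holo_atZ; apply: IH; rewrite ?E.
- move=> h; case E: (meval e _) => [a|//]; case: ifP => // ua _.
  by apply: holo_atV; [rewrite /app /mfun E|apply: IH; rewrite ?E].
Qed.

End Meromorphic.

Theorem theorem10p1 (R : realType) (d : nat) (D : pset R d) (e : mexpr R d) :
  free_open D -> holo_leaves D e ->
  forall M : point R d, D M -> ~ singular_set D e M ->
  exists delta : ncmat R d,
    in_G delta M /\
    psubset (in_G delta) (fun N => D N /\ ~ singular_set D e N) /\
    nc_on (in_G delta) (mfun e) /\ bounded_on (in_G delta) (mfun e).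
Proof.
move=> _ he M DM nsM.
have eM : meval e (projT2 M) <> None by move=> eM; apply: nsM.
have [delta [GM sub nce be]] := holo_atP he DM eM.
exists delta; split=> //; split=> // N /sub[DN eN].
by split=> // -[].
Qed.
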